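(* Let $\mathbb{D}$ be a division ring with an involution $x \mapsto x^\star$, and let $n \geq 2$ be an integer. In each one of the following cases, every range-compatible homomorphism on $\mathcal{H}_n(\mathbb{D})$ is local: (i) $\operatorname{char}(\mathbb{D}) \neq 2$; (ii) the involution $(-)^\star$ is of the second kind, unless $n=2$ and $|\mathbb{D}|=4$ (i.e. case (ii) is asserted under the proviso that it is not the case that both $n=2$ and $|\mathbb{D}|=4$).
   Context: Division rings are associative with unity $1\neq 0$ and not assumed commutative. An involution of $\mathbb{D}$ is an endomorphism $x\mapsto x^\star$ of the group $(\mathbb{D},+)$ with $(xy)^\star=y^\star x^\star$ and $(x^\star)^\star=x$ for all $x,y$ (the identity is allowed when $\mathbb{D}$ is commutative). It leaves the center of $\mathbb{D}$ invariant; it is of the first kind if it is the identity on the center, and of the second kind otherwise. For $M=(m_{i,j})\in \mathrm{M}_n(\mathbb{D})$, set $M^\star:=(m_{j,i}^\star)$; $\mathcal{H}_n(\mathbb{D})$ denotes the additive group of all $M \in \mathrm{M}_n(\mathbb{D})$ with $M^\star=M$. $\mathbb{D}^n$ is identified with the column matrices with $n$ rows and is viewed as a right $\mathbb{D}$-vector space. The range of a matrix $M\in \mathrm{M}_n(\mathbb{D})$ is the right $\mathbb{D}$-linear span of its columns in $\mathbb{D}^n$. For an additive subgroup $\mathcal{M}$ of $\mathrm{M}_n(\mathbb{D})$, a range-compatible homomorphism on $\mathcal{M}$ is a group homomorphism $F:(\mathcal{M},+)\to(\mathbb{D}^n,+)$ such that $F(M)$ belongs to the range of $M$ for all $M\in\mathcal{M}$.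 A mapping $F:\mathcal{M}\to\mathbb{D}^n$ is local if there exists $X\in\mathbb{D}^n$ such that $F(M)=MX$ for all $M\in\mathcal{M}$. *)

(* Defs.v *)
From HB Require Import structures.
From mathcomp Require Import all_boot all_order all_algebra.

Set Implicit Arguments.
Unset Strict Implicit.
Unset Printing Implicit Defensive.

Import GRing.Theory.
Local Open Scope ring_scope.

Definition division_ring (D : unitRingType) : Prop :=
  forall x : D, x != 0 -> x \is a GRing.unit.

(* [Finite.axiom s] says that every element of [T] occurs exactly once in [s]. *)
Definition has_card (T : eqType) (k : nat) : Prop :=
  exists2 s : seq T, Finite.axiom s & size s = k.

Definition involution (D : unitRingType) (star : {additive D -> D}) : Prop :=
  (forall x y : D, star (x * y) = star y * star x) /\
  (forall x : D, star (star x) = x).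

Definition central (D : unitRingType) (x : D) : Prop :=
  forall y : D, GRing.comm x y.

Definition first_kind (D : unitRingType) (star : {additive D -> D}) : Prop :=
  forall x : D, central x -> star x = x.

Definition second_kind (D : unitRingType) (star : {additive D -> D}) : Prop :=
  ~ first_kind star.

Definition starmx (D : unitRingType) (star : {additive D -> D}) (n : nat)
    (M : 'M[D]_n) : 'M[D]_n :=
  \matrix_(i, j) star (M j i).

Definition hermitian_matrices (D : unitRingType) (star : {additive D -> D}) (n : nat)
    : {pred 'M[D]_n} :=
  [pred M | starmx star M == M].

Arguments hermitian_matrices {D} star n _.

Lemma hermitian_matrices_zmod_closed (D : unitRingType) (star : {additive D -> D})
    (n : nat) : zmod_closed (hermitian_matrices star n).
Proof.
split=> [|A B]; rewrite !inE; first by apply/eqP/matrixP=> i j; rewrite !mxE raddf0.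
move=> /eqP/matrixP hA /eqP/matrixP hB; apply/eqP/matrixP=> i j.
by rewrite !mxE raddfB /= -[A i j]hA -[B i j]hB !mxE.
Qed.

(* Columns are scaled on the right, as D^n is a right vector space. *)
Definition in_range (D : unitRingType) (n : nat) (M : 'M[D]_n) (Y : 'cV[D]_n)
    : Prop :=
  exists c : 'I_n -> D, Y = \sum_(j < n) \col_(i < n) (M i j * c j).

Lemma in_rangeP (D : unitRingType) (n : nat) (M : 'M[D]_n) (Y : 'cV[D]_n) :
  in_range M Y <-> exists X : 'cV[D]_n, Y = M *m X.
Proof.
split=> [[c ->]|[X ->]]; [exists (\col_j c j) | exists (fun j => X j 0)];
  apply/matrixP=> i k; rewrite !mxE summxE; apply: eq_bigr=> j _; rewrite !mxE //.
by rewrite (ord1 k).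
Qed.

(* A map on a subgroup S of the matrices is represented by a map on all
   matrices whose values outside S are irrelevant. *)
Definition range_compatible_hom (D : unitRingType) (n : nat)
    (S : {pred 'M[D]_n}) (F : 'M[D]_n -> 'cV[D]_n) : Prop :=
  {in S &, {morph F : A B / A + B}} /\ {in S, forall M, in_range M (F M)}.

Definition local_on (D : unitRingType) (n : nat)
    (S : {pred 'M[D]_n}) (F : 'M[D]_n -> 'cV[D]_n) : Prop :=
  exists X : 'cV[D]_n, {in S, forall M, F M = M *m X}.

(* Main.v *)
Require Import Defs.
From mathcomp Require Import all_boot all_order all_algebra.

Set Implicit Arguments.
Unset Strict Implicit.
Unset Printing Implicit Defensive.

Import GRing.Theory.
Local Open Scope ring_scope.

(** Write [a'] for the conjugate of a scalar [a]. For a hermitian [M],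
    [F(M)_i = sum_j u_ij(m_ij)] for additive maps [u_ij], where [u_ii] is only
    defined on the group [H] of selfadjoint scalars. Applied to the rank-one
    matrix [v h v'] with [v = e_j + b e_i], range compatibility gives
      [u_ii(b h b') + u_ij(b h) = b (u_jj(h) + u_ji(h b'))].
    If 2 is invertible, the part of this identity that is odd in [b] reads
    [u_ij(b h) = b u_jj(h)], which is the result. In characteristic 2, an
    involution of the second kind yields a central [e] with [e + e' = 1], so
    that [D = H + H e], and polarizing in [b] shows that
    [u_ij(a) = a x + (a + a') w] and [u_jj(h) = h (x + w)] for some [x], [w].
    If [w <> 0], substituting these in the identity gives [b' = b^2] for all
    [b], whence [H = {0, 1}] and [|D| = 4]. If [n >= 3], the vectors
    [v = e_j + b e_i + c e_l] give [u_il(b c') = b u_jl(c')], and [w = 0]. *)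

(** * Sums with few nonzero terms, choice of indices, additive maps *)

Lemma big_supp2 (V : nmodType) (n : nat) (G : 'I_n -> V) (i j : 'I_n) :
  i != j -> (forall k, k != i -> k != j -> G k = 0) ->
  \sum_k G k = G i + G j.
Proof.
move=> ij G0; rewrite (bigD1 i) //= (bigD1 j) /=; last by rewrite eq_sym.
by rewrite big1 ?addr0 // => k /andP[]; apply: G0.
Qed.

Lemma big_supp3 (V : nmodType) (n : nat) (G : 'I_n -> V) (i j l : 'I_n) :
  i != j -> i != l -> j != l ->
  (forall k, k != i -> k != j -> k != l -> G k = 0) ->
  \sum_k G k = G i + G j + G l.
Proof.
move=> ij il jl G0.
rewrite (bigD1 i) //= (bigD1 j) /=; last by rewrite eq_sym.
rewrite (bigD1 l) /=; last by rewrite (eq_sym l i) il eq_sym.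
by rewrite big1 ?addr0 ?addrA // => k /andP[/andP[]]; apply: G0.
Qed.

Lemma ord_avoid2 (n : nat) (i l : 'I_n) :
  (2 < n)%N -> exists j : 'I_n, (j != i) && (j != l).
Proof.
move=> n3; have : (0 < #|~: [set i; l]|)%N.
  by rewrite cardsCs setCK card_ord subn_gt0 cards2 (leq_ltn_trans _ n3) // ltnS leq_b1.
by case/card_gt0P=> j; rewrite !inE negb_or => ?; exists j.
Qed.

Lemma ord_avoid1 (n : nat) (i : 'I_n) :
  (1 < n)%N -> exists j : 'I_n, j != i.
Proof.
move=> n2; have : (0 < #|~: [set i]|)%N.
  by rewrite cardsCs setCK card_ord subn_gt0 cards1.
by case/card_gt0P=> j; rewrite !inE => ?; exists j.
Qed.

Lemma morph_add0 (U V : zmodType) (u : U -> V) :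
  {morph u : a b / a + b} -> u 0 = 0.
Proof. by move=> uD; apply: (addrI (u 0)); rewrite -uD !addr0. Qed.

Lemma morph_addN (U V : zmodType) (u : U -> V) :
  {morph u : a b / a + b} -> {morph u : a / - a}.
Proof.
by move=> uD a; apply/eqP; rewrite -addr_eq0 -uD addNr (morph_add0 uD).
Qed.

Lemma star1 (D : unitRingType) (star : {additive D -> D}) :
  involution star -> star 1 = 1.
Proof. by case=> sM sK; rewrite -[LHS]mulr1 -{2}(sK 1) -sM mulr1 sK. Qed.

(** * The functional equation on scalar maps given by rank-one matrices *)

Definition rank1_identity (D : unitRingType) (star : {additive D -> D})
    (fi fj uij uji : D -> D) : Prop :=
  forall b h, star h = h ->
  fi (b * h * star b) + uij (b * h) = b * (fj h + uji (h * star b)).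

(** Subtracting the identity at [- b] from the one at [b] cancels the [fi] and [uji] terms, both
    even in [b], and leaves twice the claim. *)
Lemma rank1_identity_odd (D : unitRingType) (star : {additive D -> D})
    (fi fj uij uji : D -> D) :
  division_ring D -> 2%N \notin [pchar D] ->
  {morph uij : a b / a + b} -> {morph uji : a b / a + b} ->
  rank1_identity star fi fj uij uji ->
  forall b h, star h = h -> uij (b * h) = b * fj h.
Proof.
move=> hD ch2 uijD ujiD E b h hh.
have E1 := E b h hh; have := E (- b) h hh.
rewrite raddfN /= !mulNr !mulrN opprK (morph_addN uijD) (morph_addN ujiD).
rewrite mulrDr in E1; rewrite mulrDr mulrN opprD opprK => E2.
have nz2 : (2%:R : D) \is a GRing.unit.
  by apply: hD; move: ch2; rewrite inE.
apply: (mulIr nz2); rewrite !mulr_natr !mulr2n.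
set A := fi _ in E1 E2; set B := uij _ in E1 E2 *.
have -> : B + B = (A + B) - (A - B).
  by rewrite opprB [B - A]addrC addrACA subrr add0r.
by rewrite E1 E2 opprD opprK addrACA subrr addr0.
Qed.

(** Expand the identity at [b + c] and remove those at [b] and [c]: the terms in [uij] and [fj] are
    additive in [b] and drop out, so only cross terms remain. *)
Lemma rank1_identity_polar (D : unitRingType) (star : {additive D -> D})
    (fi fj uij uji : D -> D) :
  involution star ->
  (forall x y, star x = x -> star y = y -> fi (x + y) = fi x + fi y) ->
  {morph uij : a b / a + b} -> {morph uji : a b / a + b} ->
  rank1_identity star fi fj uij uji ->
  forall b c h, star h = h ->
  fi (b * h * star c + c * h * star b)
    = b * uji (h * star c) + c * uji (h * star b).
Proof.
move=> [sM sK] fiD uijD ujiD E b c h hh.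
have Eb := E b h hh; have Ec := E c h hh; have := E (b + c) h hh.
have sa x : star (x * h * star x) = x * h * star x by rewrite !sM sK hh mulrA.
have sp : star (b * h * star c + c * h * star b)
          = b * h * star c + c * h * star b.
  by rewrite raddfD /= !sM !sK hh !mulrA addrC.
have -> : (b + c) * h * star (b + c) = b * h * star b + c * h * star c
                                    + (b * h * star c + c * h * star b).
  by rewrite raddfD /= !mulrDl !mulrDr !addrA [LHS](ACl (1*4*2*3)%AC).
rewrite fiD //; last by rewrite raddfD /= !sa.
rewrite fiD // raddfD /= mulrDl [h * (_ + _)]mulrDr uijD ujiD.
set Z := fi (_ + _).
rewrite [LHS]addrAC [X in X + Z]addrACA Eb Ec.
rewrite !mulrDl !mulrDr.
set p := b * fj h; set q := c * fj h.
set r := b * uji (h * star b); set s := c * uji (h * star c).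
set t := b * uji _; set w := c * uji _.
move=> e; apply: (addrI (p + r + (q + s))); rewrite e.
rewrite !addrA.
by rewrite [LHS](ACl (1*2*4*6*3*5)%AC).
Qed.

(** The trace [c + star c] is central, selfadjoint and nonzero in characteristic 2, so [c] can be
    divided by it. *)
Lemma central_unit_trace (D : unitRingType) (star : {additive D -> D}) (c : D) :
  division_ring D -> involution star -> 2%N \in [pchar D] ->
  central c -> star c != c -> exists2 e, central e & e + star e = 1.
Proof.
move=> hD hstar ch2 cC cN; have [sM sK] := hstar.
set t := c + star c.
have tU : t \is a GRing.unit.
  by apply: hD; rewrite addr_eq0 oppr_pchar2 // eq_sym.
have tC : central t.
  move=> y; apply: commr_sym; apply: commrD; first exact/commr_sym/cC.
  by rewrite /GRing.comm -{1}(sK y) -sM cC sM sK.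
have st : star t^-1 = t^-1.
  apply: (mulIr tU); rewrite mulVr //.
  have {2}-> : t = star t by rewrite raddfD /= sK addrC.
  by rewrite -sM mulrV // star1.
exists (c * t^-1).
  move=> y; apply: commr_sym; apply: commrM; first exact/commr_sym/cC.
  exact/commrV/commr_sym/tC.
rewrite sM st cC -mulrDr mulVr //.
Qed.

(** Selfadjoint scalars are idempotent, hence 0 or 1. Every trace [a + star a] is therefore 0 or 1,
    which makes [a] or [a + e] selfadjoint. *)
Lemma has_card4 (D : unitRingType) (star : {additive D -> D}) (e : D) :
  division_ring D -> involution star -> 2%N \in [pchar D] ->
  e + star e = 1 -> (forall b, star b = b * b) -> has_card D 4.
Proof.
move=> hD hstar ch2 e1 sq; have [sM sK] := hstar.
have sa01 k : star k = k -> (k == 0) || (k == 1).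
  move=> kk; case: eqP => //= /eqP /hD kU.
  by apply/eqP; apply: (mulrI kU); rewrite -sq kk mulr1.
have e1' : star e = e + 1 by rewrite -e1 addrA addrr_pchar2 // add0r.
have n10 : (1 : D) != 0 := oner_neq0 D.
have ne0 : e != 0.
  by apply: contra_neq n10 => e0; rewrite -e1 e0 raddf0 addr0.
have ne1 : e != 1.
  apply: contra_neq n10 => e1''.
  by rewrite -[LHS]e1 e1'' (star1 hstar) addrr_pchar2.
have uq : uniq [:: 0; 1; e; e + 1].
  rewrite /= !inE !negb_or ![0 == _]eq_sym ![1 == _ + _]eq_sym [1 == e]eq_sym.
  rewrite n10 ne0 ne1 addr_eq0 oppr_pchar2 // ne1.
  by rewrite -subr_eq0 addrK ne0 eq_sym -subr_eq0 addrAC subrr add0r n10.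
exists [:: 0; 1; e; e + 1] => // a.
rewrite count_uniq_mem //.
suff -> : a \in [:: 0; 1; e; e + 1] by [].
have : (a + star a == 0) || (a + star a == 1).
  by apply: sa01; rewrite raddfD /= sK addrC.
rewrite !inE; case/orP=> /eqP ta.
  have /sa01/orP[->|->] : star a = a; rewrite ?orbT //.
  by apply/eqP; rewrite eq_sym -subr_eq0 oppr_pchar2 // ta.
have /sa01/orP[/eqP|/eqP] : star (a + e) = a + e.
- have sa : star a = a + 1 by rewrite -ta addrA addrr_pchar2 // add0r.
  by rewrite raddfD /= sa e1' addrACA [1 + 1]addrr_pchar2 // addr0.
- by move/eqP; rewrite addr_eq0 oppr_pchar2 // => ->; rewrite !orbT.
- by move/(canRL (addrK _)); rewrite oppr_pchar2 // [1 + e]addrC => ->; rewrite eqxx !orbT.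
Qed.

Lemma rank1_identity_form (D : unitRingType) (star : {additive D -> D})
    (fi fj uij uji : D -> D) (e : D) :
  involution star -> 2%N \in [pchar D] -> central e -> e + star e = 1 ->
  (forall x y, star x = x -> star y = y -> fi (x + y) = fi x + fi y) ->
  {morph uij : a b / a + b} -> {morph uji : a b / a + b} ->
  rank1_identity star fi fj uij uji ->
  (forall a, uji a = a * uji 1 + (a + star a) * (uji e - e * uji 1)) /\
  (forall t, star t = t -> fi t = t * (uji 1 + (uji e - e * uji 1))).
Proof.
move=> hstar ch2 eC e1 fiD uijD ujiD E.
have s1 := star1 hstar; have [sM sK] := hstar.
have polar := rank1_identity_polar hstar fiD uijD ujiD E.
(* Polarizing at [1], [star c] with weight [h], or at [h], [star c] with weight [1], gives the same
   left-hand side. *)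
have ujiH h c : star h = h -> uji (h * c) = h * uji c.
  move=> hh; have := polar 1 (star c) h hh; have := polar h (star c) 1 s1.
  by rewrite !sK s1 hh !(mul1r, mulr1) => -> /addIr.
split=> [a | t tt].
  set k := a + star a.
  have kk : star k = k by rewrite raddfD /= sK addrC.
  (* In characteristic 2 this splits [a] as [(a + k * e) + k * e], with selfadjoint coefficients on
     [1] and [e]. *)
  have hh : star (a + k * e) = a + k * e.
    rewrite raddfD /= sM kk.
    have -> : star e = e + 1 by rewrite -e1 addrA addrr_pchar2 // add0r.
    rewrite mulrDl mul1r eC addrCA [RHS]addrC; congr (_ + _).
    by rewrite /k addrC -addrA addrr_pchar2 // addr0.
  have {1}-> : a = (a + k * e) * 1 + k * e.
    by rewrite mulr1 -addrA addrr_pchar2 // addr0.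
  rewrite ujiD !ujiH // mulrDl mulrBr addrAC -addrA mulrA.
  by rewrite oppr_pchar2 // addrA.
(* A selfadjoint [t] is the trace of [t * e], so the polar identity computes [fi t] from [uji]. *)
have := polar 1 (star (t * e)) 1 s1.
rewrite !sK s1 !(mul1r, mulr1) sM tt.
have -> : star e * t = t * star e by rewrite -{1}tt -sM -eC sM tt.
rewrite -mulrDr e1 mulr1 ujiH // => ->.
rewrite -mulrA -mulrDr; congr (_ * _).
have -> : star e = 1 - e by rewrite -e1 addrAC subrr add0r.
by rewrite mulrBl mul1r addrCA.
Qed.

Lemma rank1_identity_linear (D : unitRingType) (star : {additive D -> D})
    (fi fj uij uji : D -> D) (e : D) :
  division_ring D -> involution star -> 2%N \in [pchar D] ->
  central e -> e + star e = 1 -> ~ has_card D 4 ->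
  (forall x y, star x = x -> star y = y -> fi (x + y) = fi x + fi y) ->
  (forall x y, star x = x -> star y = y -> fj (x + y) = fj x + fj y) ->
  {morph uij : a b / a + b} -> {morph uji : a b / a + b} ->
  rank1_identity star fi fj uij uji -> rank1_identity star fj fi uji uij ->
  forall a, uij a = a * uij 1.
Proof.
move=> hD hstar ch2 eC e1 card4 fiD fjD uijD ujiD Eij Eji.
have s1 := star1 hstar; have [sM sK] := hstar.
have [ujiE fiE] := rank1_identity_form hstar ch2 eC e1 fiD uijD ujiD Eij.
have [uijE fjE] := rank1_identity_form hstar ch2 eC e1 fjD ujiD uijD Eji.
set wi := uij e - _ in uijE fjE; set wj := uji e - _ in ujiE fiE.
clearbody wi wj.
(* The identity at [h = 1], with both normal forms substituted; at [b = 1] it gives [wi = wj]. *)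
have wE b : star b * wi = b * b * wj.
  have := Eij b 1 s1; rewrite !mulr1 mul1r.
  rewrite fiE ?sM ?sK // [uij b]uijE fjE // mul1r [uji (star b)]ujiE sK.
  rewrite !mulrDr !mulrDl !mulrDr !mulrA.
  set p := b * uij 1; set q := b * wi; set r := b * star b * uji 1.
  set s := b * star b * wj; rewrite !addrA => eq1.
  apply: (addrI (r + s + p + q)); rewrite eq1.
  by rewrite [LHS](ACl (3*4*1*2*5)%AC).
suff w0 : wi = 0 by move=> a; rewrite uijE w0 mulr0 addr0.
apply/eqP/negPn/negP => /hD wU; case: card4.
apply: (has_card4 hD hstar ch2 e1) => b; apply: (mulIr wU).
by rewrite wE; have := wE 1; rewrite s1 !mul1r => ->.
Qed.

(** * Coordinates of a range-compatible map on hermitian matrices *)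

Definition hermitian_unit (D : unitRingType) (star : {additive D -> D}) (n : nat)
    (i j : 'I_n) (a : D) : 'M[D]_n :=
  \matrix_(k, l) if (k == i) && (l == j) then a
                 else if (k == j) && (l == i) then star a else 0.

Lemma hermitian_unit_in (D : unitRingType) (star : {additive D -> D}) (n : nat)
    (i j : 'I_n) (a : D) :
  involution star -> (i == j -> star a = a) ->
  hermitian_unit star i j a \in hermitian_matrices star n.
Proof.
move=> [_ sK] sa; rewrite inE; apply/eqP/matrixP=> k l; rewrite !mxE.
rewrite [(l == i) && _]andbC [(l == j) && _]andbC.
case: ifP => [/andP[/eqP kj _]|_]; case: ifP => [/andP[/eqP ki _]|_] //.
- by apply: sa; rewrite -ki kj.
- by rewrite raddf0.
Qed.

(** Since [F M] is [M *m X] for some [X], left proportionality of rows passes to the coordinates of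
    [F M]. *)
Lemma range_compatible_row (D : unitRingType) (n : nat) (S : {pred 'M[D]_n})
    (F : 'M[D]_n -> 'cV[D]_n) (M : 'M[D]_n) (i j : 'I_n) (b : D) :
  range_compatible_hom S F -> M \in S ->
  (forall l, M i l = b * M j l) -> F M i 0 = b * F M j 0.
Proof.
move=> [_ Frange] MS Mij; have /in_rangeP[X ->] := Frange M MS.
by rewrite !mxE big_distrr /=; apply: eq_bigr => l _; rewrite Mij mulrA.
Qed.

(** Membership and value are proved together: [F] is additive only inside [S], so every partial sum
    must be known to lie there. *)
Lemma additive_on_sum (U V : zmodType) (I : finType) (S : {pred U}) (F : U -> V)
    (G : I -> U) :
  zmod_closed S -> {in S &, {morph F : x y / x + y}} ->
  (forall i, G i \in S) ->
  \sum_i G i \in S /\ F (\sum_i G i) = \sum_i F (G i).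
Proof.
move=> [S0 SB] FD GS.
have SD x y : x \in S -> y \in S -> x + y \in S.
  move=> xS yS; rewrite -[y]opprK -[- y]sub0r.
  exact: SB xS (SB _ _ S0 yS).
elim/big_rec2: _ => [|i y x _ [xS <-]]; last by rewrite SD // FD.
by split=> //; apply: (addrI (F 0)); rewrite -FD // !addr0.
Qed.

Definition coef_map (D : unitRingType) (star : {additive D -> D}) (n : nat)
    (F : 'M[D]_n -> 'cV[D]_n) (i j : 'I_n) (a : D) : D :=
  F (hermitian_unit star i j a) i 0.

Lemma coef_mapD (D : unitRingType) (star : {additive D -> D}) (n : nat)
    (F : 'M[D]_n -> 'cV[D]_n) (i j : 'I_n) (a b : D) :
  involution star -> range_compatible_hom (hermitian_matrices star n) F ->
  (i == j -> star a = a) -> (i == j -> star b = b) ->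
  coef_map star F i j (a + b) = coef_map star F i j a + coef_map star F i j b.
Proof.
move=> hstar [FD _] sa sb; rewrite /coef_map.
have -> : hermitian_unit star i j (a + b)
          = hermitian_unit star i j a + hermitian_unit star i j b.
  apply/matrixP=> k l; rewrite !mxE; case: ifP => // _.
  by case: ifP => _; rewrite ?addr0 ?raddfD.
by rewrite FD ?hermitian_unit_in // mxE.
Qed.

Lemma coef_map0 (D : unitRingType) (star : {additive D -> D}) (n : nat)
    (F : 'M[D]_n -> 'cV[D]_n) (i j : 'I_n) :
  involution star -> range_compatible_hom (hermitian_matrices star n) F ->
  coef_map star F i j 0 = 0.
Proof.
move=> hstar hF; apply: (addrI (coef_map star F i j 0)).
by rewrite -coef_mapD ?addr0 // => _; rewrite raddf0.
Qed.

Lemma coef_mapE (D : unitRingType) (star : {additive D -> D}) (n : nat)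
    (F : 'M[D]_n -> 'cV[D]_n) (M : 'M[D]_n) (i : 'I_n) :
  involution star -> range_compatible_hom (hermitian_matrices star n) F ->
  M \in hermitian_matrices star n ->
  F M i 0 = \sum_j coef_map star F i j (M i j).
Proof.
move=> hstar hF MS; have [FD _] := hF.
have Mstar k l : star (M k l) = M l k.
  by move: MS; rewrite inE => /eqP/matrixP/(_ l k); rewrite mxE.
have closed := hermitian_matrices_zmod_closed star n; have [_ SB] := closed.
have [TS FT] : \sum_j hermitian_unit star i j (M i j) \in hermitian_matrices star n
    /\ F (\sum_j hermitian_unit star i j (M i j))
       = \sum_j F (hermitian_unit star i j (M i j)).
  apply: additive_on_sum => // j.
  by apply: hermitian_unit_in => // /eqP <-.
(* [T] has the same row [i] as [M], so row [i] of [M - T] vanishes and so does that coordinate of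
   [F (M - T)]. *)
set T := \sum_j _ in TS FT.
have Ti l : T i l = M i l.
  rewrite summxE (bigD1 l) //= mxE !eqxx /= big1 ?addr0 // => j jl.
  rewrite mxE eqxx eq_sym (negPf jl) /=; case: ifP => // /andP[/eqP ij /eqP li].
  by rewrite -ij li eqxx in jl.
have MTS := SB _ _ MS TS.
rewrite -[in LHS](subrK T M) FD // mxE FT summxE.
rewrite (@range_compatible_row _ _ _ _ _ i i 0 hF MTS) ?mul0r ?add0r // => l.
by rewrite !mxE Ti subrr mul0r.
Qed.

Lemma coef_map_rank1 (D : unitRingType) (star : {additive D -> D}) (n : nat)
    (F : 'M[D]_n -> 'cV[D]_n) (v : 'I_n -> D) (h : D) (i j : 'I_n) :
  involution star -> range_compatible_hom (hermitian_matrices star n) F ->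
  star h = h -> v j = 1 ->
  \sum_k coef_map star F i k (v i * h * star (v k))
    = v i * \sum_k coef_map star F j k (h * star (v k)).
Proof.
move=> hstar hF hh vj; have [sM sK] := hstar.
pose M : 'M[D]_n := \matrix_(k, l) (v k * h * star (v l)).
have MS : M \in hermitian_matrices star n.
  by rewrite inE; apply/eqP/matrixP=> k l; rewrite !mxE !sM sK hh mulrA.
have -> : \sum_k coef_map star F i k (v i * h * star (v k)) = F M i 0.
  by rewrite (coef_mapE _ hstar) //; apply: eq_bigr => k _; rewrite mxE.
have -> : \sum_k coef_map star F j k (h * star (v k)) = F M j 0.
  by rewrite (coef_mapE _ hstar) //; apply: eq_bigr => k _; rewrite mxE vj mul1r.
by apply: (range_compatible_row hF MS) => l; rewrite !mxE vj mul1r mulrA.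
Qed.

Lemma coef_map_rank1_identity (D : unitRingType) (star : {additive D -> D})
    (n : nat) (F : 'M[D]_n -> 'cV[D]_n) (i j : 'I_n) :
  involution star -> range_compatible_hom (hermitian_matrices star n) F ->
  i != j ->
  rank1_identity star (coef_map star F i i) (coef_map star F j j)
    (coef_map star F i j) (coef_map star F j i).
Proof.
move=> hstar hF ij b h hh; have s1 := star1 hstar.
pose v k := if k == j then 1 else if k == i then b else 0.
have vi : v i = b by rewrite /v (negPf ij) eqxx.
have vj : v j = 1 by rewrite /v eqxx.
have := coef_map_rank1 i hstar hF hh vj.
rewrite !(big_supp2 ij) => [|k /negPf ki /negPf kj|k /negPf ki /negPf kj].
- by rewrite vi vj s1 !mulr1 [coef_map _ _ j i _ + _]addrC.
- by rewrite /v ki kj raddf0 mulr0 coef_map0.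
- by rewrite /v ki kj raddf0 mulr0 coef_map0.
Qed.

(** With three nonzero entries in [v], subtracting the two-index identity for [i], [j] isolates the
    terms carried by [l]. *)
Lemma coef_map_linear3 (D : unitRingType) (star : {additive D -> D})
    (n : nat) (F : 'M[D]_n -> 'cV[D]_n) (i j l : 'I_n) (b : D) :
  involution star -> range_compatible_hom (hermitian_matrices star n) F ->
  i != j -> i != l -> j != l ->
  coef_map star F i l b = b * coef_map star F i l 1.
Proof.
move=> hstar hF ij il jl; have s1 := star1 hstar; have [_ sK] := hstar.
suff key a c : coef_map star F i l (a * c) = a * coef_map star F j l c.
  by rewrite -[b in LHS]mulr1 key -[X in coef_map star F i l X]mul1r key mul1r.
pose v k := if k == j then 1 else if k == i then a
            else if k == l then star c else 0.
have vi : v i = a by rewrite /v (negPf ij) eqxx.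
have vj : v j = 1 by rewrite /v eqxx.
have vl : v l = star c by rewrite /v eq_sym (negPf jl) eq_sym (negPf il) eqxx.
have := coef_map_rank1 i hstar hF s1 vj.
rewrite !(big_supp3 ij il jl) => [|k|k]; last 2 first.
- by move=> /negPf ki /negPf kj /negPf kl; rewrite /v ki kj kl raddf0 mulr0 coef_map0.
- by move=> /negPf ki /negPf kj /negPf kl; rewrite /v ki kj kl raddf0 mulr0 coef_map0.
rewrite vi vj vl s1 sK !mulr1 !mul1r mulrDr [X in _ = a * X + _]addrC.
have := coef_map_rank1_identity hstar hF ij a s1; rewrite !mulr1 !mul1r => ->.
by move/addrI.
Qed.

Theorem theorem1p2 (D : unitRingType) (star : {additive D -> D}) (n : nat)
    (hD : division_ring D) (hstar : involution star) (hn : (2 <= n)%N)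
    (hcase : 2%N \notin [pchar D] \/
             (second_kind star /\ ~ (n = 2%N /\ has_card D 4)))
    (F : 'M[D]_n -> 'cV[D]_n)
    (hF : range_compatible_hom (hermitian_matrices star n) F) :
  local_on (hermitian_matrices star n) F.
Proof.
set u := coef_map star F.
have s1 := star1 hstar.
have uD i j : i != j -> {morph u i j : a b / a + b}.
  by move=> /negPf ij a b; apply: coef_mapD; rewrite ?ij.
have fD i x y : star x = x -> star y = y -> u i i (x + y) = u i i x + u i i y.
  by move=> sx sy; apply: coef_mapD.
have E i j (ij : i != j) := coef_map_rank1_identity hstar hF ij.
suff [offdiag diag] : (forall i j a, i != j -> u i j a = a * u j j 1) /\
    (forall j t, star t = t -> u j j t = t * u j j 1).
  exists (\col_j u j j 1) => M MS; apply/matrixP=> i k; rewrite !ord1.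
  rewrite (coef_mapE _ hstar hF MS) mxE; apply: eq_bigr => j _; rewrite mxE.
  have [<-|ij] := eqVneq i j; last exact: offdiag.
  by apply: diag; move: MS; rewrite inE => /eqP/matrixP/(_ i i); rewrite mxE.
have [ch2|ch2] := boolP (2%N \in [pchar D]); last first.
  have odd i j (ij : i != j) : forall b h, star h = h -> u i j (b * h) = b * u j j h.
    have ji : j != i by rewrite eq_sym.
    exact: rank1_identity_odd hD ch2 (uD i j ij) (uD j i ji) (E i j ij).
  split=> [i j a ij | j t tt]; first by rewrite -[a in LHS]mulr1 odd.
  have [i ij] := ord_avoid1 j hn.
  (* Both sides equal [u i j t], written as [1 * t] and then as [t * 1]. *)
  by rewrite -[LHS]mul1r -(odd i) // mul1r -[t in LHS]mulr1 odd.
have [/negP[//]|[second card4]] := hcase.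
(* Being of the second kind is a negated universal statement, so a central [e] of trace one is
   available only towards a decidable goal. *)
have by_trace1 (P : bool) :
    (forall e, central e -> e + star e = 1 -> P) -> P.
  move=> PE; apply: contraT => nP; case: second => c cC.
  apply/eqP; apply: contraT => cN.
  have [e eC e1] := central_unit_trace hD hstar ch2 cC cN.
  by rewrite (PE e) in nP.
have linear i j a : i != j -> u i j a = a * u i j 1.
  move=> ij; have ji : j != i by rewrite eq_sym.
  (* For [n = 2] the proviso excludes four elements; otherwise a third index exists. *)
  have [n2|n2] := eqVneq n 2%N.
    apply/eqP/by_trace1 => e eC e1; apply/eqP.
    by apply: (rank1_identity_linear hD hstar ch2 eC e1 _ (@fD i) (@fD j)
      (uD i j ij) (uD j i ji) (E i j ij) (E j i ji)) => D4; apply: card4.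
  have [k /andP[ki kj]] : exists k, (k != i) && (k != j).
    by apply: ord_avoid2; rewrite ltn_neqAle eq_sym n2.
  by apply: (coef_map_linear3 (j := k)); rewrite // eq_sym.
have diag i j t : i != j -> star t = t -> u j j t = t * u i j 1.
  move=> ij tt; have ji : j != i by rewrite eq_sym.
  apply/eqP/by_trace1 => e eC e1; apply/eqP.
  have [_ -> //] := rank1_identity_form hstar ch2 eC e1 (@fD j) (uD j i ji)
    (uD i j ij) (E j i ji).
  (* Left linearity of [u i j] kills the correction term of the normal form. *)
  by rewrite [u i j e]linear // subrr addr0.
have diag1 i j : i != j -> u i j 1 = u j j 1.
  by move=> ij; rewrite (diag i) // mul1r.
split=> [i j a ij | j t tt]; first by rewrite -(diag1 i) // -linear.
have [i ij] := ord_avoid1 j hn.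
by rewrite -(diag1 i) // -diag.
Qed.
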